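(* Let $X=(X_t)_{t\ge 0}$ be an arbitrary $\mathbf{F}$-adapted càdlàg real-valued stochastic process on $(\Omega,\mathcal{F},\mathbf{F},\mathbb{P})$ and let $A\subseteq\mathbb{R}$ be a Borel set such that $0\notin\overline{A}$. Put $$T_1^A(\omega):=\inf\{t>0:\Delta X_t(\omega)\in A\},\qquad T_n^A(\omega):=\inf\{t>T_{n-1}^A(\omega):\Delta X_t(\omega)\in A\}\quad(n\ge 2).$$ Then, up to an evanescent set, $(T_n^A)_{n\in\mathbb{N}}$ defines a sequence of $\mathbf{F}$-stopping times which is strictly increasing (that is, $T_n^A<T_{n+1}^A$ wherever $T_n^A<\infty$), and which satisfies $$\{\Delta X\in A\}=\bigcup_{n=1}^{\infty}[\![S_n^A]\!]\quad\text{(a union of pairwise disjoint sets)},$$ where $$S_n^A:=T_n^A\,\mathbf{1}_A\big(\Delta X_{T_n^A}\big)+(+\infty)\,\mathbf{1}_{A^c}\big(\Delta X_{T_n^A}\big).$$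
   Context: $(\Omega,\mathcal{F},\mathbf{F},\mathbb{P})$ is a filtered probability space whose filtration $\mathbf{F}=(\mathcal{F}_t)_{t\ge0}$ satisfies the usual conditions ($\mathcal{F}_0$ contains all $\mathbb{P}$-null sets and $\mathbf{F}$ is right-continuous). $\mathbb{R}^+=[0,\infty)$. A process is càdlàg if all its trajectories are right-continuous with left limits everywhere. The jump process is $\Delta X_t:=X_{t+}-X_{t-}$, with the convention $X_{0-}:=X_{0+}$. $\{\Delta X\in A\}:=\{(\omega,t)\in\Omega\times\mathbb{R}^+:\Delta X_t(\omega)\in A\}$. A stopping time is a map $T:\Omega\to[0,\infty]$ with $\{T\le t\}\in\mathcal{F}_t$ for all $t\ge0$; its graph is $[\![T]\!]:=\{(\omega,t)\in\Omega\times\mathbb{R}^+:T(\omega)=t\}$. $\overline{A}$ is the closure of $A$ and $A^c$ its complement in $\mathbb{R}$. Conventions: $\inf\emptyset=+\infty$, $0\cdot(+\infty)=0$, and $S_n^A(\omega)=+\infty$ if $T_n^A(\omega)=+\infty$. A subset of $\Omega\times\mathbb{R}^+$ is evanescent if its projection to $\Omega$ is contained in a $\mathbb{P}$-null set. *)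

(* Defs.v *)
From mathcomp Require Import all_boot all_order all_algebra.
From mathcomp Require Import all_classical all_reals all_analysis.
Set Implicit Arguments.
Unset Strict Implicit.
Unset Printing Implicit Defensive.
Import Order.TTheory GRing.Theory Num.Theory.
Import numFieldNormedType.Exports.

Local Open Scope classical_set_scope.
Local Open Scope ring_scope.

(* The time set [0, +oo[ is rendered by reals t with 0 <= t: families indexed
   by R are constrained, and used, at nonnegative times only. *)

Section filtered_space.
Context {R : realType} {d : measure_display} {Omega : measurableType d}.
Implicit Types (P : probability Omega R) (F : R -> set (set Omega)).

Definition filtration F : Prop :=
  [/\ forall t, 0 <= t -> sigma_algebra [set: Omega] (F t),
      forall t, 0 <= t -> F t `<=` measurable &
      forall s t, 0 <= s -> s <= t -> F s `<=` F t].

(* A null set is a measurable set of probability 0; completeness of the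
   probability space is not assumed. *)
Definition usual_conditions P F : Prop :=
  (forall N : set Omega, measurable N -> P N = 0%E -> F 0 N) /\
  (forall t, 0 <= t -> F t = \bigcap_(s in [set s | t < s]) F s).

Definition adapted F (X : R -> Omega -> R) : Prop :=
  forall t, 0 <= t -> forall B : set R, measurable B -> F t (X t @^-1` B).

Definition cadlag (X : R -> Omega -> R) : Prop :=
  forall w,
    (forall t, 0 <= t -> X s w @[s --> t^'+] --> X t w) /\
    (forall t, 0 < t -> cvg (X s w @[s --> t^'-])).

Definition stopping_time F (T : Omega -> \bar R) : Prop :=
  (forall w, (0 <= T w)%E) /\
  (forall t, 0 <= t -> F t [set w | (T w <= t%:E)%E]).

Definition graph (T : Omega -> \bar R) : set (Omega * R) :=
  [set x | 0 <= x.2 /\ T x.1 = (x.2)%:E].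

Definition evanescent P (E : set (Omega * R)) : Prop :=
  E `<=` [set x | 0 <= x.2] /\ P.-negligible (fst @` E).

End filtered_space.

Section jumps.
Context {R : realType} {Omega : Type}.
Implicit Types (X : R -> Omega -> R) (A : set R).

Definition right_limit X (t : R) (w : Omega) : R :=
  lim (X s w @[s --> t^'+]).

(* At time 0 the left limit is the right limit, by convention. *)
Definition left_limit X (t : R) (w : Omega) : R :=
  if t == 0 then right_limit X 0 w else lim (X s w @[s --> t^'-]).

Definition jump X (t : R) (w : Omega) : R :=
  right_limit X t w - left_limit X t w.

Definition jump_in X A : set (Omega * R) :=
  [set x | 0 <= x.2 /\ A (jump X x.2 x.1)].

(* The sequence of interest is indexed by n >= 1; the value 0 at n = 0 makes
   the first infimum range over t > 0.  [ereal_inf set0 = +oo]. *)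
Fixpoint jump_time X A (n : nat) (w : Omega) : \bar R :=
  if n is m.+1 then
    ereal_inf [set t%:E | t in [set t : R |
                 (jump_time X A m w < t%:E)%E /\ A (jump X t w)]]
  else 0%E.

(* In \bar R, [+oo * 0 = 0]. *)
Definition exact_jump_time X A (n : nat) (w : Omega) : \bar R :=
  let T := jump_time X A n w in
  if T == +oo%E then +oo%E
  else (T * (\1_A (jump X (fine T) w))%:E
        + +oo * (\1_(~` A) (jump X (fine T) w))%:E)%E.

End jumps.

(* Main.v *)
Require Import Defs.
From mathcomp Require Import all_boot all_order all_algebra.
From mathcomp Require Import all_classical all_reals all_analysis.
From mathcomp Require Import measurable_realfun lra.
Set Implicit Arguments.
Unset Strict Implicit.
Unset Printing Implicit Defensive.
Import Order.TTheory GRing.Theory Num.Theory.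
Import numFieldNormedType.Exports.

Local Open Scope classical_set_scope.
Local Open Scope ring_scope.

(** Since [0] is not in the closure of [A], there is [e > 0] such that every
jump in [A] has size at least [e]; call such jumps big.  A càdlàg path
oscillates little on each side of any time, so big jumps are isolated:
[jump_isolated] and its one-sided forms [no_jump_left] and [no_jump_right],
the latter also at time [0].  The conclusions about trajectories follow for
every [w], so that the exceptional set can be taken empty.
- The infimum that defines the next jump time is attained, because the times it
  ranges over do not accumulate from the right ([jump_timeSP]).  Hence the jump
  times increase strictly, the jump at a finite jump time is in [A], and
  [exact_jump_time] coincides with [jump_time].
- The jump times exhaust the jumps in [A]: if they all stayed below some [t],
  their supremum would be a left accumulation point of big jumps
  ([jump_time_exhaust]).

It remains to see that the jump times are stopping times.  As
[jump_timeS_leP] shows, the event [T_n.+1 <= t] is a countable combination of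
events [T_n <= q] and of events of the form: there is a jump in [A] at some
time of the interval from [q] (excluded) to [t] (included).  So everything rests
on the measurability, with respect to the process up to time [t], of such events
[jump_between X B a b] for a Borel set [B] of big jumps.  It is
obtained in three steps.
- If [B] is closed, then by compactness of the interval the event holds exactly
  when there are increments of [X] over arbitrarily short intervals, taken in
  a countable family, that come arbitrarily close to [B] ([jump_betweenP]).
- Complements are harmless on the event that an interval contains at most one
  big jump: a jump then lies outside [B] exactly when there is a big jump and no
  jump in [B].  So, restricted to this event, the sets [B] for which the event
  is measurable form a sigma-algebra, which contains the closed half-lines and
  therefore all Borel sets ([measurable_lone_jump]).
- As big jumps are isolated, each of them is the only one in some interval of a
  countable family; a countable union then removes the restriction
  ([measurable_jump_between]). *)

(** * Events about the jumps in an interval *)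

Section jump_events.
Context {R : realType} {Omega : Type}.
Implicit Types (X : R -> Omega -> R) (a b e : R) (w : Omega) (B K : set R).

Definition big_jump e : set R := [set x | e <= `|x|].

(** The right endpoint is included because the jump at [b] of a càdlàg path is
determined by the path up to [b]; the left one is not, because the jump at [a]
cannot be read off the path from [a] on. *)
Definition jump_between X B a b : set Omega :=
  [set w | exists s, [/\ a < s, s <= b & B (jump X s w)]].

Definition lone_big_jump X e a b : set Omega :=
  [set w | forall s s', a < s -> s <= b -> a < s' -> s' <= b ->
     big_jump e (jump X s w) -> big_jump e (jump X s' w) -> s = s'].

Definition near_set K e : set R := [set x | exists2 y, K y & `|x - y| < e].

(** Truncating [q] and [r] at the endpoints lets rational [q] and [r] describe
intervals that end exactly at [b], as is needed for a jump at time [b]. *)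
Definition increment_near X K a b e w q r :=
  let u := Num.max a q in let v := Num.min r b in
  [/\ u < v, v - u < e & near_set K e (X v w - X u w)].

End jump_events.

(** * Increments of a càdlàg path near a given time *)

Section path.
Context {R : realType} {disp : measure_display} {Omega : measurableType disp}.
Variable X : R -> Omega -> R.
Hypothesis X_cadlag : cadlag X.
Implicit Types (e s u v : R) (w : Omega).

Lemma at_right_dist w s e : 0 <= s -> 0 < e ->
  exists2 del : R, 0 < del &
    forall u, s <= u -> u < s + del -> `|X u w - X s w| < e.
Proof.
move=> s0 e0; have [/(_ s s0) Xs _] := X_cadlag w.
have /cvgrPdist_lt /(_ e e0) := Xs.
rewrite /at_right => -[del /= del0 Hdel]; exists del => // u su usd.
have [->|us] := eqVneq u s; first by rewrite subrr normr0.
rewrite distrC; apply: Hdel => /=; last by rewrite lt_neqAle eq_sym us.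
by rewrite distrC ger0_norm; lra.
Qed.

Lemma at_left_dist w s e : 0 < s -> 0 < e ->
  exists2 del : R, 0 < del &
    forall u, s - del < u -> u < s -> `|X u w - left_limit X s w| < e.
Proof.
move=> s0 e0; have [_ /(_ s s0) Xs] := X_cadlag w.
have /cvgrPdist_lt /(_ e e0) := Xs.
rewrite /at_left => -[del /= del0 Hdel]; exists del => // u su us.
rewrite /left_limit gt_eqF// distrC; apply: Hdel => //=.
by rewrite ger0_norm; lra.
Qed.

Lemma right_limitE w s : 0 <= s -> right_limit X s w = X s w.
Proof.
by move=> s0; apply: cvg_lim => //; have [/(_ s s0)] := X_cadlag w.
Qed.

Lemma jump0 w : jump X 0 w = 0.
Proof. by rewrite /jump /left_limit eqxx subrr. Qed.

Lemma increment_right w s e : 0 <= s -> 0 < e ->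
  exists2 del : R, 0 < del & forall u v, s <= u -> u < s + del ->
    s <= v -> v < s + del -> `|X v w - X u w| < e.
Proof.
move=> s0 e0; have [||del del0 H] := @at_right_dist w s (e / 2) => //;
  first by lra.
exists del => // u v su us sv vs; have := H u su us; have := H v sv vs.
by rewrite !ltr_norml; lra.
Qed.

Lemma increment_left w s e : 0 < s -> 0 < e ->
  exists2 del : R, 0 < del & forall u v, s - del < u -> u < s ->
    s - del < v -> v < s -> `|X v w - X u w| < e.
Proof.
move=> s0 e0; have [||del del0 H] := @at_left_dist w s (e / 2) => //;
  first by lra.
exists del => // u v su us sv vs; have := H u su us; have := H v sv vs.
by rewrite !ltr_norml; lra.
Qed.

Lemma increment_jump w s e : 0 < s -> 0 < e ->
  exists2 del : R, 0 < del & forall u v, s - del < u -> u < s ->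
    s <= v -> v < s + del -> `|X v w - X u w - jump X s w| < e.
Proof.
move=> s0 e0.
have [||d1 d10 H1] := @at_left_dist w s (e / 2) => //; first by lra.
have [||d2 d20 H2] := @at_right_dist w s (e / 2) => //; [lra..|].
exists (Num.min d1 d2) => [|u v]; first by rewrite lt_min d10.
have [m1 m2] : Num.min d1 d2 <= d1 /\ Num.min d1 d2 <= d2.
  by rewrite !ge_min !lexx orbT.
move=> su us sv vs; have := H1 u; have := H2 v.
rewrite /jump (right_limitE _ (ltW s0)) !ltr_norml => A1 A2.
have {}A1 : - (e / 2) < X v w - X s w < e / 2 by apply: A1; lra.
have {}A2 : - (e / 2) < X u w - left_limit X s w < e / 2 by apply: A2; lra.
lra.
Qed.

(** It is enough to test one increment across [s], since short increments across
[s] converge to the jump at [s]. *)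
Lemma jump_le w s e del : 0 < s -> 0 < del ->
  (forall u v, s - del < u -> u < s -> s <= v -> v < s + del ->
    `|X v w - X u w| <= e) -> `|jump X s w| <= e.
Proof.
move=> s0 del0 H; apply/ler_addgt0Pr => eta eta0.
have [d d0 Hd] := increment_jump w s0 eta0.
set k := Num.min d del.
have k0 : 0 < k by rewrite lt_min d0.
have [kd kdel] : k <= d /\ k <= del by rewrite !ge_min !lexx orbT.
have {}H : `|X s w - X (s - k / 2) w| <= e by apply: H; lra.
have {}Hd : `|X s w - X (s - k / 2) w - jump X s w| < eta by apply: Hd; lra.
move: H Hd; rewrite !ler_norml !ltr_norml; lra.
Qed.

(** Near [s] and to its right, all increments are small, hence so are the jumps,
which are limits of increments. *)
Lemma no_jump_right w s e : 0 <= s -> 0 < e ->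
  exists2 del : R, 0 < del &
    forall r, s < r -> r < s + del -> `|jump X r w| < e.
Proof.
move=> s0 e0.
have [||del del0 H] := @increment_right w s (e / 2) => //; first lra.
exists del => // r sr rs; apply: (@le_lt_trans _ _ (e / 2)); last by lra.
apply: (@jump_le _ _ _ (Num.min (r - s) (s + del - r))); first lra.
  by rewrite lt_min; lra.
have [k1 k2] : Num.min (r - s) (s + del - r) <= r - s /\
   Num.min (r - s) (s + del - r) <= s + del - r by rewrite !ge_min !lexx orbT.
by move=> u v *; apply/ltW/H; lra.
Qed.

Lemma no_jump_left w s e : 0 < s -> 0 < e ->
  exists2 del : R, 0 < del &
    forall r, s - del < r -> r < s -> `|jump X r w| < e.
Proof.
move=> s0 e0.
have [||d1 d10 H] := @increment_left w s (e / 2) => //; first lra.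
(* [jump_le] is stated at positive times, so [s - del] is kept nonnegative. *)
pose del := Num.min d1 s.
have del0 : 0 < del by rewrite lt_min d10.
have [k3 k4] : del <= d1 /\ del <= s by rewrite !ge_min !lexx orbT.
exists del => // r sr rs; apply: (@le_lt_trans _ _ (e / 2)); last by lra.
(* Radius within which both ends of an increment across [r] stay left of [s]. *)
pose k := Num.min (s - r) (r - s + del).
have [k1 k2] : k <= s - r /\ k <= r - s + del by rewrite !ge_min !lexx orbT.
apply: (@jump_le _ _ _ k); first lra.
  by rewrite lt_min; lra.
by move=> u v *; apply/ltW/H; lra.
Qed.

Lemma jump_isolated w s e : 0 < s -> 0 < e ->
  exists2 del : R, 0 < del &
    forall r, s - del < r -> r < s + del -> r != s -> `|jump X r w| < e.
Proof.
move=> s0 e0.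
have [d1 d10 H1] := no_jump_left w s0 e0.
have [d2 d20 H2] := no_jump_right w (ltW s0) e0.
exists (Num.min d1 d2) => [|r]; first by rewrite lt_min d10.
have [m1 m2] : Num.min d1 d2 <= d1 /\ Num.min d1 d2 <= d2.
  by rewrite !ge_min !lexx orbT.
by move=> sr rs; case: (ltgtP r s) => // rs' _; [apply: H1 | apply: H2]; lra.
Qed.

End path.

(** * Jumps in a closed set as limits of increments *)

Section compactness.
Context {R : realType} {disp : measure_display} {Omega : measurableType disp}.
Variable X : R -> Omega -> R.
Hypothesis X_cadlag : cadlag X.
Implicit Types (a b e s u v : R) (w : Omega) (K : set R).

(** An increment over a short interval near [s] is small when the interval lies
on one side of [s], and close to the jump at [s] when it contains [s]; in
neither case is it near [K].  If [s] is [a], every such interval lies to the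
right of [s], whence the restriction to [a < s]. *)
Lemma increment_near_local K e a s w : 0 < e -> closed K ->
  K `<=` big_jump e -> 0 <= a -> a <= s ->
  (a < s -> ~ K (jump X s w)) ->
  exists2 del : R, 0 < del & forall u v, a <= u -> s - del < u -> u < v ->
     v < s + del -> ~ near_set K del (X v w - X u w).
Proof.
move=> e0 Kcl Ke a0 as_ nK.
have small u v del : del <= e / 2 -> `|X v w - X u w| < e / 2 ->
    ~ near_set K del (X v w - X u w).
  move=> de h [y /Ke]; rewrite /big_jump /= => ey; move: h.
  have := ler_normB (X v w - X u w) ((X v w - X u w) - y).
  by rewrite opprB [_ + (y - _)]addrC subrK; lra.
have [||d1 d10 H1]
  := @increment_right _ _ _ _ X_cadlag w s (e / 2) _ _; [lra..|].
case: (ltgtP a s) as_ => // [as_|->] _; last first.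
  exists (Num.min d1 (e / 2)) => [|u v]; first by rewrite lt_min d10; lra.
  have [m1 m2] : Num.min d1 (e / 2) <= d1 /\ Num.min d1 (e / 2) <= e / 2.
    by rewrite !ge_min !lexx orbT.
  by move=> *; apply: small => //; apply: H1; lra.
have s0 : 0 < s by lra.
have [||d2 d20 H2]
  := @increment_left _ _ _ _ X_cadlag w s (e / 2) _ _; [lra..|].
have /= : nbhs (jump X s w) (~` K).
  by apply: open_nbhs_nbhs; split; [exact: closed_openC|exact: nK].
move=> /nbhs_ballP [eta /= eta0 Heta].
have [||d3 d30 H3]
  := @increment_jump _ _ _ _ X_cadlag w s (eta / 2) _ _; [lra..|].
pose del := Num.min (Num.min d1 d2) (Num.min d3 (Num.min (e / 2) (eta / 2))).
have [m1 m2 m3 m4 m5] : [/\ del <= d1, del <= d2, del <= d3,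
    del <= e / 2 & del <= eta / 2].
  by rewrite !ge_min !lexx !orbT.
exists del => [|u v au su uv vs].
  by rewrite !lt_min d10 d20 d30; lra.
have [us|su'] := ltP u s; last by apply: small => //; apply: H1; lra.
have [vs'|sv] := ltP v s; first by apply: small => //; apply: H2; lra.
move=> [y Ky xy]; apply: (Heta y) => //=.
have : `|X v w - X u w - jump X s w| < eta / 2 by apply: H3; lra.
rewrite /ball /=; move: xy; rewrite !ltr_norml; lra.
Qed.

(** A jump in [K] is a limit of increments across it.  Conversely, if increments
over shorter and shorter intervals approach [K], these intervals accumulate at
some [s] by compactness, and [increment_near_local] forces a jump in [K] at
[s]. *)
Lemma jump_betweenP K e a b w : 0 < e -> closed K ->
  K `<=` big_jump e -> 0 <= a ->
  jump_between X K a b w <->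
  forall m : nat, exists q r : rat,
    increment_near X K a b m.+1%:R^-1 w (ratr q) (ratr r).
Proof.
move=> e0 Kcl Ke a0; split=> [[s [as_ sb Ks]] m|H].
  have m0 : 0 < m.+1%:R^-1 :> R by rewrite invr_gt0.
  move: (m.+1%:R^-1) m0 => h h0.
  have [||d d0 Hd]
  := @increment_jump _ _ _ _ X_cadlag w s h _ _; [lra..|].
  have [q] : exists q : rat, ratr q \in `]Num.max a (s - Num.min d (h / 2)), s[.
    apply: rat_in_itvoo; rewrite gt_max as_ /=.
    by rewrite gtrBl lt_min d0; lra.
  rewrite in_itv /= gt_max => /andP[/andP[aq sq] qs].
  have [r] : exists r : rat, ratr r \in `]s, s + Num.min d (h / 2)[.
    by apply: rat_in_itvoo; rewrite ltrDl lt_min d0; lra.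
  rewrite in_itv /= => /andP[sr rs].
  have [m1 m2] : Num.min d (h / 2) <= d /\ Num.min d (h / 2) <= h / 2.
    by rewrite !ge_min !lexx orbT.
  exists q, r; rewrite /increment_near (max_r (ltW aq)).
  have [n1 n2] : s <= Num.min (ratr r) b /\ Num.min (ratr r) b <= ratr r.
    by rewrite le_min ge_min lexx sb ltW.
  split; [lra|lra|exists (jump X s w) => //].
  by apply: Hd; lra.
apply: contrapT => nJ.
have [q Hq] := choice H; have {Hq}[r Hqr] := choice Hq.
pose u m := Num.max a (ratr (q m)); pose v m := Num.min (ratr (r m)) b.
have uab m : u m \in `[a, b].
  have [uv _ _] := Hqr m; rewrite in_itv /= /u le_max lexx /=.
  by apply: ltW; apply: lt_le_trans uv _; rewrite ge_min lexx orbT.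
have [s sab scl] : exists2 s : R, s \in `[a, b] & cluster (u @ \oo) s.
  have [|s [sab scl]] := @segment_compact R a b (u @ \oo) _; last by exists s.
  by exists 0%N => // n _; exact: uab.
have /andP[as_ sb] : a <= s <= b by move: sab; rewrite in_itv.
have [|del del0 Hdel] := @increment_near_local K e a s w e0 Kcl Ke a0 as_.
  by move=> as' Ks; apply: nJ; exists s.
have h0 : 0 < del / 2 by lra.
have [y [[n /= Hn Hny] ys]] :
    [set u n | n in [set n | n.+1%:R^-1 < del / 2]] `&` ball s (del / 2) !=set0.
  apply: scl; last exact: nbhsx_ballx.
  apply: filterS (near_infty_natSinv_lt (PosNum h0)) => n /= Hn.
  by exists n.
have [uv vu [k Kk kn]] := Hqr n.
rewrite -/(u n) -/(v n) in uv vu kn.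
have au : a <= u n by rewrite /u le_max lexx.
have {}vu : v n - u n < del / 2 := lt_trans vu Hn.
have {}kn : `|X (v n) w - X (u n) w - k| < del / 2 := lt_trans kn Hn.
move: ys; rewrite -Hny /ball /= ltr_norml => ys.
by apply: (Hdel (u n) (v n)) => //; [lra..|exists k => //; lra].
Qed.

End compactness.

(** * Measurability of the jump events *)

Lemma measurable_guard {disp : measure_display} {Omega : measurableType disp}
    (p : Prop) (D : set Omega) :
  (p -> measurable D) -> measurable [set w | p /\ D w].
Proof.
have [p1 /(_ p1) Dm|np _] := pselect p.
  by rewrite (_ : [set w | _] = D)//; apply/seteqP; split=> w // [].
by rewrite (_ : [set w | _] = set0)//; apply/seteqP; split=> w // [].
Qed.

Lemma measurable_exists_rat {disp : measure_display}
    {Omega : measurableType disp} (D : rat -> set Omega) :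
  (forall q, measurable (D q)) -> measurable [set w | exists q, D q w].
Proof.
move=> Dm; rewrite (_ : [set w | _] = \bigcup_q D q).
  exact: bigcupT_measurable_rat.
by apply/seteqP; split=> w [q]; exists q.
Qed.

Lemma open_near_set {R : realType} (K : set R) (e : R) : open (near_set K e).
Proof.
rewrite (_ : near_set K e = \bigcup_(y in K) ball y e).
  by apply: bigcup_open => y _; exact: ball_open.
by apply/seteqP; split=> x [y Ky xy]; exists y => //; move: xy;
  rewrite /ball /= distrC.
Qed.

Lemma closed_big_jump {R : realType} (e : R) : closed (big_jump e).
Proof.
rewrite (_ : big_jump e = (fun x : R => `|x|) @^-1` [set x | e <= x])//.
by apply: preimage_closed => [x _|]; [exact: norm_continuous|exact: closed_ge].
Qed.

Section measurability.
Context {R : realType} {disp : measure_display} {Omega : measurableType disp}.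
Variables (X : R -> Omega -> R) (t : R).
Hypothesis X_cadlag : cadlag X.
Hypothesis X_measurable :
  forall s, 0 <= s -> s <= t -> measurable_fun [set: Omega] (X s).
Implicit Types (a b e s u v : R) (w : Omega) (B K : set R).

Lemma measurable_increment_near K a b e (q r : R) : 0 <= a -> b <= t ->
  measurable [set w | increment_near X K a b e w q r].
Proof.
move=> a0 bt; rewrite /increment_near /=.
set u := Num.max a q; set v := Num.min r b.
rewrite (_ : [set w | _] = [set w | (u < v /\ v - u < e) /\
    ((X v \- X u) @^-1` near_set K e) w]); last first.
  by apply/seteqP; split=> w; [case|case; case].
apply: measurable_guard => -[uv _].
have u0 : 0 <= u by rewrite le_max a0.
have vt : v <= t by rewrite ge_min bt orbT.
rewrite -[X in measurable X]setTI.
have : measurable_fun [set: Omega] (X v \- X u).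
  by apply: measurable_funB; apply: X_measurable; lra.
by apply => //; apply: open_measurable; exact: open_near_set.
Qed.

Lemma measurable_jump_closed K e a b : 0 < e -> closed K ->
  K `<=` big_jump e -> 0 <= a -> b <= t ->
  measurable (jump_between X K a b).
Proof.
move=> e0 Kcl Ke a0 bt.
rewrite (_ : jump_between X K a b = \bigcap_m [set w | exists q : rat,
   exists r : rat, increment_near X K a b m.+1%:R^-1 w (ratr q) (ratr r)]).
  apply: bigcapT_measurable => m; apply: measurable_exists_rat => q.
  by apply: measurable_exists_rat => r; exact: measurable_increment_near.
apply/seteqP; split=> w.
  by move=> /(jump_betweenP X_cadlag b w e0 Kcl Ke a0) H m _; exact: H.
by move=> H; apply/(jump_betweenP X_cadlag b w e0 Kcl Ke a0) => m; exact: H.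
Qed.

(** Two big jumps at distinct times are separated by a rational time. *)
Lemma measurable_lone_big_jump e a b : 0 < e -> 0 <= a -> b <= t ->
  measurable (lone_big_jump X e a b).
Proof.
move=> e0 a0 bt; rewrite -[X in measurable X]setCK; apply: measurableC.
rewrite (_ : ~` _ = [set w | exists q : rat, (a < ratr q /\ ratr q < b) /\
    (jump_between X (big_jump e) a (ratr q) `&`
     jump_between X (big_jump e) (ratr q) b) w]).
  apply: measurable_exists_rat => q; apply: measurable_guard => -[aq qb].
  by apply: measurableI; apply: (@measurable_jump_closed _ e) => //;
    do ?[exact: closed_big_jump]; lra.
apply/seteqP; split=> w.
  apply: contra_notP => nq.
  suff H s s' : a < s -> s <= b -> a < s' -> s' <= b ->
     big_jump e (jump X s w) -> big_jump e (jump X s' w) -> ~ s < s'.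
    move=> s s' as_ sb as' sb' Js Js'.
    by have [||//] := ltgtP s s' => ss'; exfalso;
      [apply: (H s s')|apply: (H s' s)].
  move=> as_ sb as' sb' Js Js' ss'; apply: nq.
  have [q] := rat_in_itvoo ss'; rewrite in_itv /= => /andP[sq qs'].
  exists q; split; first by split; lra.
  by split; [exists s|exists s']; split => //; lra.
move=> [q [[aq qb] [[s [as_ sq Js]] [s' [qs' sb' Js']]]]] H.
suff : s = s' by lra.
by apply: H => //; lra.
Qed.

(** The Borel sets [B] for which the claim holds form a sigma-algebra.  Closure
under complements rests on uniqueness: without [lone_big_jump], a big jump
outside [B] could coexist with one in [B]. *)
Lemma measurable_lone_jump e B a b : 0 < e -> measurable B ->
  0 <= a -> b <= t ->
  measurable (lone_big_jump X e a b `&` jump_between X (B `&` big_jump e) a b).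
Proof.
move=> e0 mB a0 bt; set L := lone_big_jump X e a b.
have mL : measurable L by exact: measurable_lone_big_jump.
pose G := [set C | measurable (L `&` jump_between X (C `&` big_jump e) a b)].
suff GB : <<s @RGenCInfty.G R >> `<=` G.
  by apply: GB; have := mB;
    rewrite /measurable /= [X in X B]RGenCInfty.measurableE.
apply: smallest_sub; last first.
  move=> _ [c ->]; apply: measurableI => //.
  apply: (@measurable_jump_closed _ e) => //.
  by apply: closedI; [rewrite set_itvE; exact: closed_ge|exact: closed_big_jump].
split.
- rewrite /G /= (_ : _ `&` _ = set0)//.
  by apply/seteqP; split=> w // [_ [s [_ _ []]]].
- move=> C mC; rewrite /G /=.
  rewrite (_ : _ `&` _ = (L `&` jump_between X (big_jump e) a b) `\`
      (L `&` jump_between X (C `&` big_jump e) a b)).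
    apply: measurableD => //; apply: measurableI => //.
    by apply: (@measurable_jump_closed _ e) => //; exact: closed_big_jump.
  apply/seteqP; split=> w.
    move=> [Lw [s [as_ sb [[_ nC] Js]]]]; split; first by split=> //; exists s.
    move=> [_ [s' [as' sb' [Cs' Js']]]].
    by apply: nC; rewrite (Lw s s').
  move=> [[Lw [s [as_ sb Js]]] nC]; split=> //.
  exists s; split=> //; split=> //; split=> // Cs.
  by apply: nC; split=> //; exists s.
- move=> C mC; rewrite /G /=.
  rewrite (_ : _ `&` _ = \bigcup_k
      (L `&` jump_between X (C k `&` big_jump e) a b)).
    by apply: bigcupT_measurable => k; exact: mC.
  apply/seteqP; split=> w.
    move=> [Lw [s [as_ sb [[k _ Ck] Js]]]]; exists k => //; split=> //.
    by exists s.
  move=> [k _ [Lw [s [as_ sb [Ck Js]]]]]; split=> //.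
  by exists s; split=> //; split=> //; exists k.
Qed.

(** Isolating a jump between rationals, truncated at [a] and [b], reduces the
claim to countably many instances of [measurable_lone_jump]. *)
Lemma measurable_jump_between e B a b : 0 < e -> measurable B ->
  B `<=` big_jump e -> 0 <= a -> b <= t -> measurable (jump_between X B a b).
Proof.
move=> e0 mB Be a0 bt.
rewrite (_ : jump_between X B a b = [set w | exists q : rat, exists r : rat,
    let u := Num.max a (ratr q) in let v := Num.min (ratr r) b in
    (lone_big_jump X e u v `&` jump_between X (B `&` big_jump e) u v) w]).
  apply: measurable_exists_rat => q; apply: measurable_exists_rat => r /=.
  by apply: measurable_lone_jump => //;
    [rewrite le_max a0|rewrite ge_min bt orbT].
apply/seteqP; split=> w.
  move=> [s [as_ sb Bs]]; have s0 : 0 < s by lra.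
  have [del del0 H] := jump_isolated X_cadlag w s0 e0.
  have [q] : exists q : rat, ratr q \in `]Num.max a (s - del), s[.
    by apply: rat_in_itvoo; rewrite gt_max as_ /=; lra.
  rewrite in_itv /= gt_max => /andP[/andP[aq sq] qs].
  have [r] : exists r : rat, ratr r \in `]s, s + del[.
    by apply: rat_in_itvoo; lra.
  rewrite in_itv /= => /andP[sr rs].
  exists q, r => /=; rewrite (max_r (ltW aq)).
  have [n1 n2] : s <= Num.min (ratr r) b /\ Num.min (ratr r) b <= ratr r.
    by rewrite le_min ge_min lexx sb ltW.
  split; last by exists s; split=> //; split=> //; exact: Be.
  suff U x : ratr q < x -> x <= Num.min (ratr r) b ->
      big_jump e (jump X x w) -> x = s.
    by move=> x y qx xr qy yr Jx Jy; rewrite (U x)// (U y).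
  move=> qx xr; apply: contraPP => /eqP xs; apply/negP; rewrite -ltNge.
  by apply: H => //; lra.
move=> [q [r [_ [s [us sv [Bs _]]]]]]; exists s; split=> //.
  by apply: le_lt_trans us; rewrite le_max lexx.
by apply: (le_trans sv); rewrite ge_min lexx orbT.
Qed.

End measurability.

(** * The sequence of jump times *)

Section jump_times.
Context {R : realType} {disp : measure_display} {Omega : measurableType disp}.
Variables (X : R -> Omega -> R) (A : set R) (e : R).
Hypothesis X_cadlag : cadlag X.
Hypothesis e_gt0 : 0 < e.
Hypothesis A_big : A `<=` big_jump e.
Implicit Types (s t : R) (w : Omega) (n m : nat).

Lemma jump_time_ge0 n w : (0 <= jump_time X A n w)%E.
Proof.
elim: n => [|n IH] //=; apply: le_ereal_inf_tmp => _ [s [Ts _] <-].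
by apply: ltW; exact: le_lt_trans IH Ts.
Qed.

Lemma jump_timeS_le n w s : (jump_time X A n w < s%:E)%E ->
  A (jump X s w) -> (jump_time X A n.+1 w <= s%:E)%E.
Proof. by move=> Ts As; apply: ereal_inf_lbound; exists s. Qed.

(** Times of jumps in [A] do not accumulate from the right at the infimum, so
the infimum is one of them. *)
Lemma jump_timeSP n w : jump_time X A n.+1 w = +oo%E \/
  exists s, [/\ jump_time X A n.+1 w = s%:E,
                (jump_time X A n w < s%:E)%E & A (jump X s w)].
Proof.
rewrite /=; set Z := [set s | _]; set T := jump_time X A n w in Z *.
have [Z0|] := eqVneq Z set0; first by left; rewrite Z0 image_set0 ereal_inf0.
move=> /set0P[z [Tz Az]].
have : T \is a fin_num.
  by rewrite ge0_fin_numE ?jump_time_ge0// (lt_trans Tz)// ltry.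
case ET : T => [a| |] // _.
have a0 : 0 <= a by rewrite -lee_fin -ET jump_time_ge0.
have Zlb : (a%:E <= ereal_inf [set x%:E | x in Z])%E.
  by apply: le_ereal_inf_tmp => _ [x [Tx _] <-]; rewrite -ET ltW.
have Zub : (ereal_inf [set x%:E | x in Z] <= z%:E)%E.
  by apply: ereal_inf_lbound; exists z.
case EI : (ereal_inf _) Zlb Zub => [i| |] //; rewrite !lee_fin => ai iz.
right; exists i; suff Zi : Z i by rewrite -ET; case: Zi.
have i0 : 0 <= i by exact: le_trans ai.
have [del del0 H] := no_jump_right X_cadlag w i0 e_gt0.
have [_ [x Zx <-]] : exists2 y, [set x%:E | x in Z] y & (y < (i + del)%:E)%E.
  by apply: ereal_inf_lt; rewrite EI lte_fin; lra.
rewrite lte_fin => xi.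
have : (i%:E <= x%:E)%E by rewrite -EI; apply: ereal_inf_lbound; exists x.
rewrite lee_fin le_eqVlt => /orP[/eqP-> //|ix].
by have := H x ix xi; case: Zx => _ /A_big /=; rewrite ltNge => ->.
Qed.

Lemma jump_time_lt n m w : (n < m)%N -> (jump_time X A n w < +oo)%E ->
  (jump_time X A n w < jump_time X A m w)%E.
Proof.
move=> nm Tn; elim: m nm => // m IH; rewrite ltnS leq_eqVlt => /orP[/eqP<-|nm].
  by have [->|[s [-> ? _]]] := jump_timeSP n w.
have [->//|[s [-> Ts _]]] := jump_timeSP m w.
exact: lt_trans (IH nm) Ts.
Qed.

Lemma exact_jump_timeE n w : (0 < n)%N ->
  exact_jump_time X A n w = jump_time X A n w.
Proof.
case: n => // n _; rewrite /exact_jump_time.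
have [->//|[s [-> _ As]]] := jump_timeSP n w.
rewrite /= !indicE mem_set// memNset; last by move=> /=; apply.
by rewrite mule1 mule0 adde0.
Qed.

(** If all jump times were below [t], they would be infinitely many times of big
jumps accumulating at their supremum from the left.  Otherwise the first jump
time that is at least [t] is [t] itself, since [t] is among the times over which
its infimum is taken. *)
Lemma jump_time_exhaust t w : 0 <= t -> A (jump X t w) ->
  exists2 n, (0 < n)%N & jump_time X A n w = t%:E.
Proof.
move=> t0 At; have {}t0 : 0 < t.
  rewrite lt_neqAle t0 andbT; apply/negP => /eqP t0'.
  by move: (A_big At); rewrite /big_jump -t0' jump0 /= normr0 leNgt e_gt0.
have [|nT] := pselect (exists n, (t%:E <= jump_time X A n w)%E); last first.
  have Tt n : (jump_time X A n w < t%:E)%E.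
    by rewrite ltNge; apply/negP => ?; apply: nT; exists n.
  have Too n : (jump_time X A n w < +oo)%E by rewrite (lt_trans (Tt n))// ltry.
  have [tau Htau] : exists tau : nat -> R,
      forall n, jump_time X A n w = (tau n)%:E.
    exists (fun n => fine (jump_time X A n w)) => n.
    by rewrite fineK// ge0_fin_numE ?jump_time_ge0.
  have tauS n : tau n < tau n.+1.
    by rewrite -lte_fin -!Htau; exact: jump_time_lt.
  have tauA n : A (jump X (tau n.+1) w).
    have [|[s [Es _ As]]] := jump_timeSP n w; first by rewrite Htau.
    by move: Es; rewrite Htau => -[->].
  have ub n : tau n <= t by rewrite -lee_fin -Htau ltW.
  have hs : has_sup (range tau).
    by split; [exists (tau 0%N), 0%N|exists t => _ [n _ <-]].
  have le_sup n : tau n <= sup (range tau).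
    by apply: ub_le_sup; [case: hs|exists n].
  have s0 : 0 < sup (range tau).
    apply: (lt_le_trans _ (le_sup 1%N)); apply: le_lt_trans (tauS 0%N).
    by rewrite -lee_fin -Htau jump_time_ge0.
  have [del del0 H] := no_jump_left X_cadlag w s0 e_gt0.
  have [_ [n _ <-] Hn] := sup_adherent del0 hs.
  have := H _ (lt_trans Hn (tauS n)) (lt_le_trans (tauS n.+1) (le_sup _)).
  by rewrite ltNge (A_big (tauA n)).
move=> exT; case: (ex_minnP exT) => -[|n] tT min_n.
  by move: tT; rewrite /= lee_fin leNgt t0.
exists n.+1 => //; apply/eqP; rewrite eq_le tT andbT.
apply: jump_timeS_le => //; rewrite ltNge; apply/negP => /min_n.
by rewrite ltnn.
Qed.

(** A rational time between [T_n] and [T_n.+1], available since the infimum is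
attained after [T_n], decouples the two. *)
Lemma jump_timeS_leP n t w : (jump_time X A n.+1 w <= t%:E)%E <->
  exists q : rat, [/\ 0 <= (ratr q : R), ratr q < t,
    (jump_time X A n w <= (ratr q)%:E)%E & jump_between X A (ratr q) t w].
Proof.
split=> [|[q [q0 qt Tq [s [qs st As]]]]]; last first.
  apply: (@le_trans _ _ s%:E); last by rewrite lee_fin.
  by apply: jump_timeS_le => //; apply: le_lt_trans Tq _; rewrite lte_fin.
have [->//|[s [-> Ts As]]] := jump_timeSP n w; rewrite lee_fin => st.
have T0 := jump_time_ge0 n w.
case: (jump_time X A n w) Ts T0 => [p| |] //; rewrite lte_fin lee_fin => ps p0.
have [q] := rat_in_itvoo ps; rewrite in_itv /= => /andP[pq qs].
exists q; split; [lra|lra|by rewrite lee_fin ltW|].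
by exists s.
Qed.

Lemma measurable_jump_time_le t n :
  (forall s, 0 <= s -> s <= t -> measurable_fun [set: Omega] (X s)) ->
  measurable A -> 0 <= t ->
  measurable [set w | (jump_time X A n w <= t%:E)%E].
Proof.
move=> mX mA.
elim: n t mX => [|n IH] t mX t0.
  rewrite (_ : [set w | _] = setT) //.
  by apply/seteqP; split=> w // _; rewrite /= lee_fin.
rewrite (_ : [set w | _] = [set w | exists q : rat,
    (0 <= (ratr q : R) /\ ratr q < t) /\
    ([set w | (jump_time X A n w <= (ratr q)%:E)%E] `&`
     jump_between X A (ratr q) t) w]).
  apply: measurable_exists_rat => q; apply: measurable_guard => -[q0 qt].
  apply: measurableI; last exact: (@measurable_jump_between _ _ _ X t _ _ e).
  by apply: IH => // s s0 sq; apply: mX => //; lra.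
by apply/seteqP; split=> w /=; rewrite jump_timeS_leP => -[q];
  [case=> *; exists q|case=> -[? ?] [? ?]; exists q].
Qed.

End jump_times.

(** * Conclusion *)

Lemma away_from0 (R : realType) (A : set R) : ~ closure A 0 ->
  exists2 e, 0 < e & A `<=` big_jump e.
Proof.
move=> A0; apply: contrapT => nA; apply: A0 => U /nbhs_ballP[e /= e0 eU].
apply: contrapT => /set0P/negP/negPn/eqP AU0; apply: nA; exists e => // x Ax /=.
rewrite /big_jump /= leNgt; apply/negP => xe.
suff : (A `&` U) x by rewrite AU0.
by split=> //; apply: eU; rewrite /ball /= sub0r normrN.
Qed.

(** Measurability up to time [t] is that of the space equipped with the
sigma-algebra [F t], for which [X s] is measurable when [s <= t]. *)
Lemma stopping_time_jump_time (R : realType) (d : measure_display)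
    (Omega : measurableType d) (F : R -> set (set Omega)) (X : R -> Omega -> R)
    (A : set R) (e : R) (n : nat) :
  filtration F -> adapted F X -> cadlag X -> measurable A ->
  0 < e -> A `<=` big_jump e -> stopping_time F (jump_time X A n).
Proof.
move=> [Fsig _ Fmono] FX Xc mA e0 Ae; split=> [w|t t0].
  exact: jump_time_ge0.
rewrite -(sigma_algebra_id (Fsig t t0)).
apply: (@measurable_jump_time_le R _ (g_sigma_algebraType (F t)) X A e) => //.
move=> s s0 st _ B mB; rewrite setTI; apply: sub_sigma_algebra.
by apply: (Fmono s t) => //; exact: FX.
Qed.

Theorem proposition1 (R : realType) (d : measure_display)
    (Omega : measurableType d) (P : probability Omega R)
    (F : R -> set (set Omega)) (X : R -> Omega -> R) (A : set R)
    (F_filtration : filtration F) (F_usual : usual_conditions P F)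
    (X_adapted : adapted F X) (X_cadlag : cadlag X)
    (A_borel : measurable A) (A_away0 : ~ closure A 0) :
  exists E : set (Omega * R), [/\ evanescent P E,
    forall n, (0 < n)%N -> stopping_time F (jump_time X A n),
    forall w, ~ (fst @` E) w -> forall n, (0 < n)%N ->
      (jump_time X A n w < +oo)%E ->
      (jump_time X A n w < jump_time X A n.+1 w)%E,
    jump_in X A `\` E =
      \bigcup_(n in [set n | (0 < n)%N]) (graph (exact_jump_time X A n) `\` E) &
    trivIset [set n | (0 < n)%N]
      (fun n => graph (exact_jump_time X A n) `\` E)].
Proof.
have [e e0 Ae] := away_from0 A_away0.
exists set0; rewrite image_set0; split.
- by split; [exact: sub0set|rewrite image_set0; exact: negligible_set0].
- by move=> n _; exact: stopping_time_jump_time e0 Ae.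
- by move=> w _ n _; exact: (jump_time_lt X_cadlag e0 Ae).
- rewrite setD0; under eq_bigcupr do rewrite setD0.
  apply/seteqP; split=> -[w t] /=.
    move=> [/= t0 At].
    have [n n0 Tn] := jump_time_exhaust X_cadlag e0 Ae t0 At.
    by exists n => //; split=> //=; rewrite (exact_jump_timeE X_cadlag e0 Ae).
  move=> [[//|n] _ [/= t0]]; rewrite (exact_jump_timeE X_cadlag e0 Ae)// => Tn.
  split=> //=; have [|[s []]] := jump_timeSP X_cadlag e0 Ae n w.
    by rewrite Tn.
  by rewrite Tn => -[->].
- move=> n m /= n0 m0 [[w t] [[[_ /= Sn] _] [[_ /= Sm] _]]].
  rewrite (exact_jump_timeE X_cadlag e0 Ae)// in Sn.
  rewrite (exact_jump_timeE X_cadlag e0 Ae)// in Sm.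
  have [nm|mn|//] := ltngtP n m.
    have := jump_time_lt X_cadlag e0 Ae nm (w := w).
    by rewrite Sn Sm ltxx => /(_ (ltry _)).
  have := jump_time_lt X_cadlag e0 Ae mn (w := w).
  by rewrite Sn Sm ltxx => /(_ (ltry _)).
Qed.
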